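(* For all positive integers $n,p$, $$\Omega(\mathtt{RP}(n,p))\le \mathtt{PO}(n,p)\le O(\mathtt{RP}(n,p)\log n).$$
   Context: Given a directed graph $G=(V,E)$ and a set $P\subseteq V\times V$ of demand pairs, a reachability preserver is a subgraph $H\subseteq G$ such that for every $(s,t)\in P$ for which $G$ has an $s\leadsto t$ path, $H$ also has one. $\mathtt{RP}(n,p)$ is the least integer such that every $n$-node directed graph and set of $|P|=p$ demand pairs has a reachability preserver on at most $\mathtt{RP}(n,p)$ edges. A path oracle for $G,P$ is a data structure (a bit string, together with a fixed decoding procedure) that, when queried with any $(s,t)\in P$, reports an $s\leadsto t$ path in $G$ (or ''no path'' if none exists). $\mathtt{PO}(n,p)$ is the smallest integer such that every $n$-node directed graph and set of $|P|=p$ demand pairs has a path oracle on at most $\mathtt{PO}(n,p)$ bits. *)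

(* Defs.v *)
From Stdlib Require Import ClassicalEpsilon.
From mathcomp Require Import all_boot.
Set Implicit Arguments. Unset Strict Implicit. Unset Printing Implicit Defensive.

(* A directed graph on the n nodes 'I_n is a relation G : rel 'I_n
   (G x y means there is an edge x -> y).  Demand pairs are a finite set
   P : {set 'I_n * 'I_n}.  Reachability is [connect G] (reflexive-transitive
   closure, i.e. existence of a directed path, the empty path included). *)

Definition nedges (n : nat) (G : rel 'I_n) : nat :=
  #|[set e : 'I_n * 'I_n | G e.1 e.2]|.

Definition subgraph (n : nat) (H G : rel 'I_n) : Prop :=
  forall x y, H x y -> G x y.

Definition reach_preserver (n : nat) (G : rel 'I_n) (P : {set 'I_n * 'I_n})
  (H : rel 'I_n) : Prop :=
  subgraph H G /\
  forall s t, (s, t) \in P -> connect G s t -> connect H s t.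

Definition RP_bound (n p k : nat) : Prop :=
  forall (G : rel 'I_n) (P : {set 'I_n * 'I_n}), #|P| = p ->
    exists H : rel 'I_n, reach_preserver G P H /\ nedges H <= k.

(* A decoding procedure: from a bit string and a query (s,t), it returns
   either [None] ("no path") or [Some q], meaning the path s :: q. *)
Definition decoder (n : nat) := seq bool -> 'I_n -> 'I_n -> option (seq 'I_n).

Definition path_oracle (n : nat) (G : rel 'I_n) (P : {set 'I_n * 'I_n})
  (D : decoder n) (b : seq bool) : Prop :=
  forall s t, (s, t) \in P ->
    if connect G s t then
      exists q, D b s t = Some q /\ path G s q /\ last s q = t
    else D b s t = None.

Definition PO_bound (n p k : nat) : Prop :=
  exists D : decoder n,
    forall (G : rel 'I_n) (P : {set 'I_n * 'I_n}), #|P| = p ->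
      exists b : seq bool, size b <= k /\ path_oracle G P D b.

(* least natural number satisfying a Prop predicate (0 if none exists;
   for RP_bound and PO_bound some bound always exists). *)
Definition prop_to_bool (A : Prop) : bool :=
  if excluded_middle_informative A then true else false.

Lemma prop_to_boolP (A : Prop) : reflect A (prop_to_bool A).
Proof. by rewrite /prop_to_bool; case: excluded_middle_informative => h; constructor. Qed.

Definition least_nat (Q : nat -> Prop) : nat :=
  match excluded_middle_informative (exists k, Q k) with
  | left h =>
      @ex_minn (fun k => prop_to_bool (Q k))
        (let: ex_intro k hk := h in ex_intro _ k (introT (prop_to_boolP _) hk))
  | right _ => 0
  end.

Definition RP (n p : nat) : nat := least_nat (RP_bound n p).
Definition PO (n p : nat) : nat := least_nat (PO_bound n p).

(* Main.v *)
From Stdlib Require Import ClassicalEpsilon.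
Require Import Defs.
From mathcomp Require Import all_boot zify.
Set Implicit Arguments. Unset Strict Implicit. Unset Printing Implicit Defensive.

(* Upper bound: an oracle may store the edge list of a smallest preserver.

   Lower bound: call a system of paths bridge-free if two nodes of a path are
   joined by no other route through the system. Deleting arbitrary interior
   nodes from the paths of such a system keeps every path the only route between
   its ends, so an oracle recovers all deletions: it needs one bit per interior
   node. From a graph G, take in- and out-trees of the strongly connected
   components (at most 2n edges) and a minimal set D of edges between components
   completing them to a preserver. Charge each edge of D to a demand pair that
   needs it; the tails of the edges charged to one pair form a path, and these
   paths are bridge-free. Hence PO >= |D| - 2p, and the terms 2n and 2p are
   absorbed by PO >= n - 2 (one path through all nodes) and
   PO >= min(p, floor(n/2) * ceil(n/2)) (bipartite graphs). *)

(** * Least values, subsets of given size and counting of short codes *)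

Lemma least_natP (Q : nat -> Prop) :
  (exists k, Q k) -> Q (least_nat Q) /\ forall k, Q k -> least_nat Q <= k.
Proof.
move=> exQ; rewrite /least_nat; case: excluded_middle_informative => // h.
case: ex_minnP => m /prop_to_boolP Qm min_m; split=> // k Qk.
exact/min_m/prop_to_boolP.
Qed.

Lemma exists_subset_card (T : finType) (B : {set T}) k :
  k <= #|B| -> exists2 A : {set T}, A \subset B & #|A| = k.
Proof.
move=> le_k; exists [set x in take k (enum B)].
  by apply/subsetP=> x; rewrite inE => /mem_take; rewrite mem_enum.
rewrite cardsE (card_uniqP (take_uniq _ (enum_uniq _))) size_take -cardE.
by case: ltngtP le_k.
Qed.

Lemma exists_superset_card (T : finType) (B : {set T}) k :
  #|B| <= k <= #|T| -> exists2 A : {set T}, B \subset A & #|A| = k.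
Proof.
case/andP=> le_Bk le_kT.
have [|A sAB cA] := @exists_subset_card _ (~: B) (k - #|B|).
  by rewrite [#|~: B|]cardsCs setCK leq_sub2r.
exists (B :|: A); first exact: subsetUl.
rewrite cardsU cA (_ : B :&: A = set0) ?cards0 ?subn0 ?subnKC //.
apply/eqP; rewrite -subset0; apply/subsetP=> x; rewrite !inE.
by case/andP=> xB /(subsetP sAB); rewrite inE xB.
Qed.

(* Appending a [true] marker and padding with [false] never produces the
   all-false word, whence the strict inequality. *)
Lemma card_lt_short_codes (T : finType) (k : nat) (f : T -> seq bool) (A : {set T}) :
  {in A &, injective f} -> (forall x, x \in A -> size (f x) <= k) ->
  #|A| < 2 ^ k.+1.
Proof.
move=> f_inj f_size.
pose pad b := b ++ true :: nseq (k - size b) false.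
have pad_size x : x \in A -> size (pad (f x)) == k.+1.
  move=> xA; rewrite size_cat /= size_nseq addnS subnKC //; exact: f_size.
have pad_inj b c : pad b = pad c -> b = c.
  rewrite /pad => /(congr1 rev); rewrite !rev_cat !rev_cons !rev_nseq !cat_rcons.
  move: (k - size b) (k - size c) => i j.
  elim: i j => [|i IH] [|j] //= []; last exact: IH.
  exact: (can_inj revK).
pose g (x : T) : k.+1.-tuple bool := insubd [tuple of nseq k.+1 false] (pad (f x)).
have valg x : x \in A -> val (g x) = pad (f x).
  by move=> xA; rewrite val_insubd pad_size.
have g_inj : {in A &, injective g}.
  by move=> x y xA yA /(congr1 val); rewrite !valg // => /pad_inj/f_inj; apply.
rewrite -(card_in_imset g_inj) -card_bool -card_tuple -[ltnRHS]cardsT.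
apply/proper_card/properP; split; first exact: subsetT.
exists [tuple of nseq k.+1 false]; first by rewrite inE.
apply/imsetP=> -[x xA] /(congr1 val); rewrite valg //.
move/(congr1 (fun s => true \in s)); rewrite mem_cat mem_head orbT.
by rewrite mem_nseq andbF.
Qed.

(** * Lower bounds on oracles from families of graphs *)

(** A code shared by two subsets would be an oracle for both graphs, so the [2 ^ #|A|] subsets need
    distinct codes. [P] is enlarged because [PO_bound] speaks of exactly [p] pairs. *)
Lemma PO_bound_separated n p k (T : finType) (A : {set T})
    (Gf : {set T} -> rel 'I_n) (P : {set 'I_n * 'I_n}) :
  #|P| <= p <= n * n ->
  (forall (S S' : {set T}) (D : decoder n) b, S \subset A -> S' \subset A ->
     path_oracle (Gf S) P D b -> path_oracle (Gf S') P D b -> S = S') ->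
  PO_bound n p k -> #|A| <= k.
Proof.
move=> le_p sep [D oD].
have [|P' sPP' cP'] := @exists_superset_card _ P p.
  by rewrite card_prod card_ord.
have exb S : { b | size b <= k /\ path_oracle (Gf S) P D b }.
  apply: constructive_indefinite_description.
  have [b [sb ob]] := oD (Gf S) P' cP'; exists b; split=> // s t st.
  by apply: ob; apply: (subsetP sPP').
rewrite -ltnS -(ltn_exp2l _ _ (isT : 1 < 2)) -card_powerset.
apply: (@card_lt_short_codes _ k (fun S => sval (exb S))) => [S S'|S _].
  rewrite !inE => sS sS' eqb; apply: (sep S S' D (sval (exb S))) => //.
    by case: (svalP (exb S)).
  by rewrite eqb; case: (svalP (exb S')).
by case: (svalP (exb S)).
Qed.

Lemma card_ord_lt n h : h <= n -> #|[set s : 'I_n | s < h]| = h.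
Proof.
by move=> le_hn; rewrite -sum1dep_card (big_ord_narrow le_hn) sum1_card card_ord.
Qed.

(** Every edge leads from the lower to the upper half, so no path has two edges: a pair of [A] is
    connected exactly when it is itself an edge, and the answers determine the edge set. *)
Lemma PO_bound_bipartite n p k (A : {set 'I_n * 'I_n}) :
  (forall s t, (s, t) \in A -> s < n./2 <= t) ->
  #|A| <= p <= n * n -> PO_bound n p k -> #|A| <= k.
Proof.
move=> bipA le_p.
apply: (@PO_bound_separated _ _ _ _ A (fun S x y => (x, y) \in S) A le_p).
suff sep (S S' : {set 'I_n * 'I_n}) (D : decoder n) b : S \subset A -> S' \subset A ->
    path_oracle (fun x y => (x, y) \in S) A D b ->
    path_oracle (fun x y => (x, y) \in S') A D b -> S \subset S'.
  move=> S S' D b sS sS' oS oS'; apply/eqP; rewrite eqEsubset.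
  by apply/andP; split; [exact: sep oS oS' | exact: sep oS' oS].
move=> sS sS' oS oS'; apply/subsetP=> -[s t] stS.
have stA := subsetP sS _ stS.
have := oS s t stA; rewrite (connect1 (stS : (fun x y => (x, y) \in S) s t)).
case=> q [Dq _]; have := oS' s t stA; case: ifP => [_ [q' [_ [pq lq]]]|]; last first.
  by rewrite Dq.
have /andP[lt_s le_t] := bipA _ _ stA.
case: q' pq lq => [_ /= eq_st|y q' /= /andP[sy pq] lq].
  by move: le_t; rewrite -eq_st leqNgt lt_s.
case: q' pq lq => [_ <- //|z q' /= /andP[yz _] _].
have /andP[_ le_y] := bipA _ _ (subsetP sS' _ sy).
have /andP[lt_y _] := bipA _ _ (subsetP sS' _ yz).
by move: le_y; rewrite leqNgt lt_y.
Qed.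

(** * Bridge-free path systems *)

Lemma exists_minimal (I : finType) (lt : rel I) (A : {set I}) e0 :
  irreflexive lt -> transitive lt -> e0 \in A ->
  exists2 m, m \in A & forall g, g \in A -> ~~ lt g m.
Proof.
move=> lt_irr lt_tr e0A.
case: (arg_minnP (fun f => #|[set g in A | lt g f]|) e0A) => m mA min_m.
exists m => // g gA; apply/negP=> lt_gm; have := min_m g gA.
rewrite leqNgt => /negP; apply; apply/proper_card/properP; split.
  apply/subsetP=> h; rewrite !inE => /andP[-> lt_hg]; exact: lt_tr lt_gm.
by exists g; rewrite !inE gA // lt_irr.
Qed.

(** Used for the first item of each path and, with the order reversed, for the last. *)
Lemma exists_class_min (I : finType) (J : eqType) (cl : I -> J) (lt : rel I) :
  irreflexive lt -> transitive lt ->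
  (forall e f, cl e = cl f -> [|| e == f, lt e f | lt f e]) ->
  exists lo : I -> I, [/\ forall e, cl (lo e) = cl e,
    forall e f, cl e = cl f -> lo e = lo f &
    forall e, lo e = e \/ lt (lo e) e].
Proof.
move=> lt_irr lt_tr lt_tot.
have min_ex e : { m | cl m = cl e /\ forall g, cl g = cl e -> ~~ lt g m }.
  apply: constructive_indefinite_description.
  have [|m] := @exists_minimal _ lt [set f | cl f == cl e] e lt_irr lt_tr.
    by rewrite inE.
  rewrite inE => /eqP cl_m min_m; exists m; split=> // g cl_g.
  by apply: min_m; rewrite inE cl_g.
exists (fun e => sval (min_ex e)); split=> [e|e f|e].
- by case: (svalP (min_ex e)).
- case: (min_ex e) (min_ex f) => m /= [cl_m min_m] [m' /= [cl_m' min_m']] ef.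
  have /or3P[/eqP //||] := lt_tot m m' (etrans cl_m (etrans ef (esym cl_m'))).
    by rewrite (negbTE (min_m' _ _)) // cl_m.
  by rewrite (negbTE (min_m _ _)) // cl_m'.
case: (min_ex e) => m /= [cl_m min_m].
have /or3P[/eqP ->||] := lt_tot _ _ cl_m; [by left | by right |].
by rewrite (negbTE (min_m _ _)).
Qed.

(* An item [e : I] is one occurrence of the node [tl e] on the path [cl e]; [lt]
   orders the items along each path, and [C] is any preorder containing all
   routes through the system. *)
Record bridge_free n (I J : finType) (tl : I -> 'I_n) (cl : I -> J)
    (lt : rel I) (C : rel 'I_n) : Prop := BridgeFree {
  bf_irr : irreflexive lt;
  bf_trans : transitive lt;
  bf_total : forall e f, cl e = cl f -> [|| e == f, lt e f | lt f e];
  bf_inj : forall e f, cl e = cl f -> tl e = tl f -> e = f;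
  bf_refl : reflexive C;
  bf_Ctrans : transitive C;
  bf_lt_C : forall e f, lt e f -> C (tl e) (tl f);
  bf_no_bridge : forall e f f' g, cl f = cl f' -> lt f f' -> cl e = cl g ->
    tl e = tl f -> C (tl f') (tl g) -> e = f }.

(** The system after the items outside [K] are deleted: each path jumps from one kept item to the
    next. *)
Definition kept_graph n (I J : finType) (tl : I -> 'I_n) (cl : I -> J)
    (lt : rel I) (K : {set I}) : rel 'I_n :=
  fun x y => [exists e, exists f,
    [&& e \in K, f \in K, cl e == cl f, lt e f, tl e == x, tl f == y &
        [forall g, ~~ [&& g \in K, cl g == cl e, lt e g & lt g f]]]].

Lemma kept_graphP n (I J : finType) (tl : I -> 'I_n) (cl : I -> J)
    (lt : rel I) (K : {set I}) x y :
  reflect (exists e f, [/\ e \in K, f \in K, cl e = cl f & lt e f] /\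
             [/\ tl e = x, tl f = y &
               forall g, g \in K -> cl g = cl e -> lt e g -> ~~ lt g f])
          (kept_graph tl cl lt K x y).
Proof.
apply: (iffP existsP) => [[e /existsP[f]]|[e [f [[eK fK cef ef] [ex fy nog]]]]].
  case/and5P=> eK fK /eqP cef ef /and3P[/eqP ex /eqP fy /forallP nog].
  exists e, f; split; split=> // g gK cg eg.
  by have := nog g; rewrite gK cg eqxx eg.
exists e; apply/existsP; exists f; rewrite eK fK cef ef ex fy !eqxx /=.
apply/forallP=> g; apply/negP=> /and4P[gK /eqP cg eg].
by apply/negP/nog; rewrite // cef.
Qed.

Section BridgeFree.

Context (n : nat) (I J : finType) (tl : I -> 'I_n) (cl : I -> J).
Context (lt : rel I) (C : rel 'I_n) (bf : bridge_free tl cl lt C).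

Lemma kept_path_C (K : {set I}) x p : path (kept_graph tl cl lt K) x p -> C x (last x p).
Proof.
elim: p x => [|y p IHp] x /=; first by move=> _; apply: (bf_refl bf).
case/andP=> /kept_graphP[e [f [[_ _ _ ef] [<- <- _]]]] /IHp.
exact: (bf_Ctrans bf) (bf_lt_C bf ef).
Qed.

(** The first edge may come from another path crossing at [tl e]; since the walk still reaches
    [tl m], [bf_no_bridge] identifies the two items. So the walk advances to the next kept item of
    its own path and skips none. *)
Lemma kept_path_mem (K : {set I}) e m p :
  e \in K -> cl e = cl m -> (forall g, cl g = cl m -> g = m \/ lt g m) ->
  path (kept_graph tl cl lt K) (tl e) p -> last (tl e) p = tl m ->
  forall x, x \in tl e :: p <->
    exists g, [/\ g \in K, cl g = cl m, g = e \/ lt e g & tl g = x].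
Proof.
move=> eK cem max_m; elim: p e eK cem => [|y p IHp] e eK cem /=.
  move=> _ /(bf_inj bf cem) em x; rewrite inE; split=> [/eqP ->|].
    by exists e; split=> //; left.
  case=> g [gK cg [-> -> //|eg <-]].
  have [-> | gm] := max_m g cg; first by rewrite em.
  by have := bf_trans bf eg gm; rewrite em (bf_irr bf).
case/andP=> /kept_graphP[f [f' [[fK f'K cff' ff'] [fe <- nog]]]] pp lp.
have Cf' := kept_path_C pp; rewrite lp in Cf'.
have ef : e = f := bf_no_bridge bf cff' ff' cem (esym fe) Cf'.
move: cff' ff' fe nog; rewrite -{f fK}ef => cef' ef' _ nog x.
have cf'm := etrans (esym cef') cem.
rewrite inE; split.
  case/predU1P=> [-> | /(IHp f' f'K cf'm pp lp x)[g [gK cg gf' gx]]].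
    by exists e; split=> //; left.
  exists g; split=> //; right.
  by case: gf' => [-> //|]; apply: (bf_trans bf).
case=> g [gK cg eg gx]; case: eg => [<- | eg]; first by rewrite gx eqxx.
apply/predU1P; right; apply/(IHp f' f'K cf'm pp lp x); exists g; split=> //.
have /or3P[/eqP ->||] := bf_total bf (etrans cg (esym cf'm)).
- by left.
- by rewrite (negbTE (nog g gK (etrans cg (esym cem)) eg)).
by right.
Qed.

Lemma kept_connect (K : {set I}) e m :
  e \in K -> m \in K -> cl e = cl m -> e = m \/ lt e m ->
  connect (kept_graph tl cl lt K) (tl e) (tl m).
Proof.
move=> eK mK; move: {2}_.+1 (ltnSn #|[set g | lt e g]|) => N.
elim: N e eK => // N IHN e eK; rewrite ltnS => leN cem [-> | em]; first by [].
pose A := [set g in K | (cl g == cl e) && lt e g].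
have mA : m \in A by rewrite inE mK cem eqxx.
have [f] := exists_minimal (bf_irr bf) (bf_trans bf) mA.
rewrite inE => /and3P[fK /eqP cf ef] min_f.
apply: (connect_trans (y := tl f)).
  apply/connect1/kept_graphP; exists e, f; do 2!split=> //.
  by move=> g gK cg eg; apply: min_f; rewrite inE gK cg eqxx.
apply: IHN => //; first last.
- have /or3P[/eqP ->||mf] := bf_total bf (etrans cf cem); [by left|by right|].
  by have := min_f m mA; rewrite mf.
- exact: etrans cf cem.
apply: leq_trans leN; apply/proper_card/properP; split.
  by apply/subsetP=> g; rewrite !inE; apply: (bf_trans bf).
by exists f; rewrite !inE ?ef // (bf_irr bf).
Qed.

(** Each path gets its pair of ends as demand pair and always keeps its first and last items, which
    costs at most two items per path. The remaining items may be deleted freely, and the reported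
    path shows which were. *)
Lemma PO_bound_bridge_free p k :
  #|cl @: [set: I]| <= p <= n * n -> PO_bound n p k ->
  #|I| <= k + 2 * #|cl @: [set: I]|.
Proof.
case/andP=> le_clp le_pn POk.
have [lo [cl_lo lo_eq lo_le]] :=
  exists_class_min (bf_irr bf) (bf_trans bf) (bf_total bf).
have [|||hi [cl_hi hi_eq hi_ge]] := @exists_class_min _ _ cl (fun e f => lt f e).
- exact: (bf_irr bf).
- by move=> y x z xy yz; apply: (bf_trans bf) yz xy.
- by move=> e f /(bf_total bf); rewrite [lt f e || _]orbC.
have card_ext (h : I -> I) : (forall e, cl (h e) = cl e) ->
    (forall e f, cl e = cl f -> h e = h f) ->
    #|h @: [set: I]| <= #|cl @: [set: I]|.
  move=> cl_h h_eq; rewrite -(@card_in_imset _ _ cl).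
    by apply/subset_leq_card/subsetP=> _ /imsetP[x _ ->]; apply: imset_f.
  move=> _ _ /imsetP[e _ ->] /imsetP[f _ ->]; rewrite !cl_h; exact: h_eq.
pose B := lo @: [set: I] :|: hi @: [set: I].
pose P := [set (tl e, tl (hi e)) | e in lo @: [set: I]].
have cardP : #|P| <= p.
  exact: leq_trans (leq_imset_card _ _) (leq_trans (card_ext _ cl_lo lo_eq) _).
have cardB : #|B| <= 2 * #|cl @: [set: I]|.
  by rewrite mul2n -addnn (leq_trans (leq_card_setU _ _)) // leq_add ?card_ext.
suff le_k : #|~: B| <= k by rewrite -(cardsC B) addnC leq_add.
apply: (@PO_bound_separated n p k _ (~: B)
          (fun S => kept_graph tl cl lt (S :|: B)) P) POk => [|S S' D b sS sS'].
  by rewrite cardP.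
have loB e : lo e \in B by rewrite inE imset_f.
have hiB e : hi e \in B by rewrite inE orbC imset_f.
suff sep (S1 S2 : {set I}) : path_oracle (kept_graph tl cl lt (S1 :|: B)) P D b ->
    path_oracle (kept_graph tl cl lt (S2 :|: B)) P D b ->
    S1 \subset ~: B -> S1 \subset S2.
  move=> o1 o2; apply/eqP; rewrite eqEsubset.
  by apply/andP; split; [exact: sep o1 o2 sS | exact: sep o2 o1 sS'].
have oracleE (S0 : {set I}) g : path_oracle (kept_graph tl cl lt (S0 :|: B)) P D b ->
  exists q, D b (tl (lo g)) (tl (hi g)) = Some q /\
    (forall x, x \in tl (lo g) :: q <-> exists f,
      [/\ f \in S0 :|: B, cl f = cl (hi g), f = lo g \/ lt (lo g) f & tl f = x]).
  move=> o; have loK : lo g \in S0 :|: B by rewrite inE loB orbT.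
  have hiK : hi g \in S0 :|: B by rewrite inE hiB orbT.
  have clh : cl (lo g) = cl (hi g) by rewrite cl_lo cl_hi.
  have max_hi f : cl f = cl (hi g) -> f = hi g \/ lt f (hi g).
    move=> cf; have -> : hi g = hi f by apply: hi_eq; rewrite cf cl_hi.
    by case: (hi_ge f) => [->|]; [left|right].
  have /o : (tl (lo g), tl (hi g)) \in P.
    apply/imsetP; exists (lo g); first exact: imset_f.
    by rewrite (hi_eq (lo g) g).
  rewrite kept_connect //; last exact: max_hi.
  case=> q [Dq [pq lq]]; exists q; split=> // x.
  exact: (kept_path_mem loK clh max_hi pq lq x).
move=> o1 o2 s1; apply/subsetP=> g gS1.
have [q [Dq memq]] := oracleE S1 g o1.
have [q' [Dq' memq']] := oracleE S2 g o2.
have gB : g \notin B by move/(subsetP s1): gS1; rewrite inE.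
(* Both oracles decode the same word, so they report the same path. *)
have eqq : q' = q by move: Dq'; rewrite Dq => -[].
have /memq' : tl g \in tl (lo g) :: q'.
  rewrite eqq; apply/memq; exists g; split=> //; first by rewrite inE gS1.
  by case: (lo_le g) => [-> |]; [left|right].
case=> f [fK cf _ /(bf_inj bf)fg].
by move: fK; rewrite fg ?cf ?cl_hi // inE (negbTE gB) orbF.
Qed.

End BridgeFree.

(** The system is a single path through all nodes in increasing order; the [2] accounts for its
    ends. *)
Lemma PO_bound_order n p k :
  0 < p <= n * n -> PO_bound n p k -> n <= k + 2.
Proof.
move=> p_bnd POk.
have bf : @bridge_free n 'I_n unit id (fun=> tt) (fun i j => i < j)
            (fun i j => i <= j).
  split=> //.
  - by move=> i; apply: ltnn.
  - by move=> j i l; apply: ltn_trans.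
  - by move=> i j _; rewrite -val_eqE /=; case: ltngtP.
  - by move=> j i l; apply: leq_trans.
  - by move=> i j /ltnW.
have card1 : #|(fun=> tt) @: [set: 'I_n]| <= 1.
  by rewrite -card_unit max_card.
have := PO_bound_bridge_free bf _ POk; rewrite card_ord.
move/(_ _)=> H; apply: leq_trans (H _) _.
  by case/andP: p_bnd => p_gt0 ->; rewrite (leq_trans card1).
by rewrite leq_add2l -{2}[2]muln1 leq_mul2l.
Qed.

(** * Trees in strongly connected components *)

(** [f x] is the second node of a shortest path from [x] to its root [r x]. The root does not change
    along this step, so the distance drops and iterating [f] reaches it. *)
Lemma exists_in_tree (T : finType) (G : rel T) (r : T -> T) :
  (forall x, connect G x (r x)) ->
  (forall x y, G x y -> connect G y (r x) -> r y = r x) ->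
  exists f : T -> T, (forall x, x != r x -> G x (f x)) /\
    forall x, connect (fun x y => (x != r x) && (y == f x)) x (r x).
Proof.
move=> Gr r_eq.
have dist_ex x : exists d, [exists p : d.-tuple T, path G x p && (last x p == r x)].
  have /connectP[p pp lp] := Gr x; exists (size p); apply/existsP.
  by exists (in_tuple p); rewrite pp -lp eqxx.
pose d x := ex_minn (dist_ex x).
have step x : { y | x != r x -> [/\ G x y, r y = r x & d y < d x] }.
  apply: constructive_indefinite_description.
  have [/eqP eq_x|ne_x] := boolP (x == r x); first by exists x.
  rewrite /d; case: ex_minnP => m /existsP[p /andP[pp /eqP lp]] min_m.
  case: p pp lp => -[|y q] /= sz_q; first by move=> _ eq_x; rewrite -eq_x eqxx in ne_x.
  case/andP=> xy pq lq; exists y => _.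
  have ry : r y = r x by apply: r_eq => //; apply/connectP; exists q.
  split=> //; case: ex_minnP => m' _ min_m'.
  rewrite -(eqP sz_q) ltnS; apply: min_m'; apply/existsP.
  by exists (in_tuple q); rewrite pq lq ry eqxx.
have [f fP] : exists f : T -> T,
    forall x, x != r x -> [/\ G x (f x), r (f x) = r x & d (f x) < d x].
  by exists (fun x => sval (step x)) => x; apply: (svalP (step x)).
exists f; split=> [x /fP[] // | x].
move: {2}_.+1 (ltnSn (d x)) => N; elim: N x => // N IHN x; rewrite ltnS => leN.
have [eq_x|ne_x] := eqVneq x (r x); first by rewrite -eq_x.
have [_ ry lt_d] := fP x ne_x.
apply: (connect_trans (y := f x)); first by apply: connect1; rewrite ne_x eqxx.
by rewrite -ry; apply: IHN; apply: leq_trans leN.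
Qed.

(** The root of each component gets an in-tree and, from the reversed graph, an out-tree, each with
    at most one edge per node; [x] reaches [y] through the root. *)
Lemma exists_scc_spanner n (G : rel 'I_n) :
  exists F : {set 'I_n * 'I_n}, [/\ #|F| <= 2 * n,
    forall x y, (x, y) \in F -> G x y &
    forall x y, connect G x y -> connect G y x ->
      connect (fun x y => (x, y) \in F) x y].
Proof.
pose scc x := [pred y | connect G x y && connect G y x].
(* [pick] returns the same node for equal predicates, so [r] is constant on components; the default
   is never taken, as [x] lies in its own component. *)
pose r x := odflt x [pick y | scc x y].
have rP x : scc x (r x).
  rewrite /r; case: pickP => //= _; by rewrite connect0.
have r_eq x y : scc x y -> r y = r x.
  case/andP=> xy yx; rewrite /r; have -> : [pick z | scc y z] = [pick z | scc x z].
    apply: eq_pick => z /=; apply/andP/andP=> -[az za]; split;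
      by [apply: connect_trans az | apply: connect_trans za _].
  by case: pickP => //= /(_ x); rewrite /= connect0.
have [||f [Gf conf]] := @exists_in_tree _ G r.
- by move=> x; have /andP[] := rP x.
- move=> x y xy yr; apply: r_eq; rewrite /= connect1 //=.
  by apply: connect_trans yr _; have /andP[] := rP x.
have [||g [Gg cong]] := @exists_in_tree _ [rel x y | G y x] r.
- by move=> x; rewrite connect_rev; have /andP[] := rP x.
- move=> x y /= yx; rewrite connect_rev /= => ry; apply: r_eq.
  rewrite /= (connect1 yx) andbT; apply: connect_trans ry.
  by have /andP[] := rP x.
pose F := [set (x, f x) | x in [set x | x != r x]]
      :|: [set (g x, x) | x in [set x | x != r x]].
have FG x y : (x, y) \in F -> G x y.
  rewrite inE => /orP[]/imsetP[z]; rewrite inE => ne_z [-> ->]; first exact: Gf.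
  exact: Gg.
exists F; split=> // [|x y xy yx].
  rewrite mul2n -addnn (leq_trans (leq_card_setU _ _)) // leq_add //;
    by rewrite (leq_trans (leq_imset_card _ _)) // (leq_trans (max_card _)) ?card_ord.
apply: (connect_trans (y := r x)).
  apply: connect_sub (conf x) => u v /andP[ne_u /eqP ->]; apply: connect1.
  by rewrite inE imset_f // inE.
rewrite -(r_eq x y) /= ?xy //.
have := connect_rev (fun x y => (x != r x) && (y == g x)) (r y) y.
rewrite /= cong; apply: connect_sub => u v /= /andP[ne_v /eqP ->]; apply: connect1.
by rewrite inE orbC imset_f // inE.
Qed.

(** * Critical edges and small preservers *)

Definition del_edge (T : eqType) (H : rel T) (x y : T) : rel T :=
  fun u v => H u v && ((u, v) != (x, y)).

(** The walk is cut at its first use of the edge: the part before avoids the edge, while the part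
    after may use it again. *)
Lemma connect_del_edge (T : finType) (H : rel T) x y a b :
  connect H a b ->
  connect (del_edge H x y) a b \/
  connect (del_edge H x y) a x /\ connect H y b.
Proof.
case/connectP=> p; elim: p a => [|c p IHp] a /=.
  by move=> _ ->; left.
case/andP=> ac pp lb; have [[-> cy]|ne] := eqVneq (a, c) (x, y).
  by rewrite cy in pp lb; right; split=> //; apply/connectP; exists p.
have ac' : connect (del_edge H x y) a c by apply: connect1; rewrite /del_edge ac.
case: (IHp c pp lb) => [cb|[cx yb]]; first by left; apply: connect_trans cb.
by right; split=> //; apply: connect_trans cx.
Qed.

Lemma connect_to_del_edge (T : finType) (H : rel T) x y a :
  connect H a x -> connect (del_edge H x y) a x.
Proof. by move/(connect_del_edge x y)=> [|[]]. Qed.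

(* A route leaving the path of [e] at its tail through another edge cannot come
   back to that tail, as no edge of [D] lies on a cycle; if it rejoined the path
   later, the pair charged with [e] would be connected without [e]. *)
Lemma bridge_free_critical n (H : rel 'I_n) (D : {set 'I_n * 'I_n})
    (cl : {e | e \in D} -> 'I_n * 'I_n) :
  (forall e, e \in D -> H e.1 e.2) ->
  (forall e, e \in D -> ~~ connect H e.2 e.1) ->
  (forall e, connect H (cl e).1 (cl e).2) ->
  (forall e, ~~ connect (del_edge H (val e).1 (val e).2) (cl e).1 (cl e).2) ->
  bridge_free (fun e => (val e).1) cl
    (fun e f => connect H (val e).2 (val f).1) (connect H).
Proof.
move=> DH acyc con crit.
have edge (e : {e | e \in D}) : H (val e).1 (val e).2 by apply/DH/valP.
have acyclic (e : {e | e \in D}) : connect H (val e).2 (val e).1 = false.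
  exact/negbTE/acyc/valP.
have split_e e : connect H (cl e).1 (val e).1 /\ connect H (val e).2 (cl e).2.
  have sub : subrel (connect (del_edge H (val e).1 (val e).2)) (connect H).
    by apply: connect_sub => x y /andP[xy _]; apply: connect1.
  case: (connect_del_edge (val e).1 (val e).2 (con e)) => [|[/sub]//].
  by rewrite (negbTE (crit e)).
(* If neither order held, the route through [e] would avoid [f] and connect the pair charged with
   [f]. *)
have total e f : cl e = cl f ->
    [|| e == f, connect H (val e).2 (val f).1 | connect H (val f).2 (val e).1].
  move=> ef; have [//|ne /=] := eqVneq e f.
  have [se et] := split_e e.
  case: (connect_del_edge (val f).1 (val f).2 se) => [se'|[_ ->]]; last exact: orbT.
  case: (connect_del_edge (val f).1 (val f).2 et) => [et'|[/(connect_sub _)]]; last first.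
    move=> sub _; apply/orP; left; apply: sub => x y /andP[xy _]; exact: connect1.
  case/negP: (crit f); rewrite -ef; apply: connect_trans se' _.
  apply: connect_trans et'; apply: connect1; rewrite /del_edge edge /=.
  by rewrite -!surjective_pairing (inj_eq val_inj).
split=> //.
- by move=> f e g ef fg; apply: connect_trans ef (connect_trans (connect1 (edge f)) fg).
- move=> e f /total /or3P[/eqP // | |]; first by move=> ef eq_t; rewrite -eq_t acyclic in ef.
  by move=> fe eq_t; rewrite eq_t acyclic in fe.
- exact: connect_trans.
- by move=> e f; apply: connect_trans (connect1 (edge e)).
move=> e f f' g _ ff' eg eq_t f'g; apply/eqP/negPn/negP=> ne.
case/negP: (crit e).
have [se _] := split_e e; have [_ gt] := split_e g.
have ft : connect H (val f).2 (cl e).2.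
  rewrite eg; apply: connect_trans ff' (connect_trans f'g _).
  exact: connect_trans (connect1 (edge g)) gt.
apply: connect_trans (connect_to_del_edge _ se) _.
case: (connect_del_edge (val e).1 (val e).2 ft) => [ft'|[/(connect_sub _) sub _]].
  apply: connect_trans ft'; apply: connect1; rewrite eq_t /del_edge edge /= -eq_t.
  by rewrite -surjective_pairing {1}eq_t -surjective_pairing (inj_eq val_inj) eq_sym.
suff: connect H (val f).2 (val f).1 by rewrite acyclic.
by rewrite -eq_t; apply: sub => x y /andP[xy _]; apply: connect1.
Qed.

Lemma small_preserver n p k (G : rel 'I_n) (P : {set 'I_n * 'I_n}) :
  #|P| = p -> p <= n * n -> PO_bound n p k ->
  exists H : rel 'I_n, reach_preserver G P H /\ nedges H <= 2 * n + (k + 2 * p).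
Proof.
move=> cP le_pn POk.
have [F [cF FG Fscc]] := exists_scc_spanner G.
pose inter := [set e : 'I_n * 'I_n | G e.1 e.2 && ~~ connect G e.2 e.1].
pose union (D : {set 'I_n * 'I_n}) : rel 'I_n :=
  fun x y => ((x, y) \in F) || ((x, y) \in D).
pose good (D : {set 'I_n * 'I_n}) := (D \subset inter) &&
  [forall e : 'I_n * 'I_n, (e \in P) ==> connect G e.1 e.2 ==> connect (union D) e.1 e.2].
have good_inter : good inter.
  rewrite /good subxx; apply/forallP=> e; apply/implyP=> _; apply/implyP.
  apply: connect_sub => x y xy; have [yx|nyx] := boolP (connect G y x).
    apply: connect_sub (Fscc _ _ (connect1 xy) yx) => u v uv; apply: connect1.
    by rewrite /union uv.
  by apply: connect1; rewrite /union inE xy nyx orbT.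
have [D /minsetP[/andP[sD goodD] minD] _] := minset_exists good_inter.
have unionG : subgraph (union D) G.
  move=> x y /orP[/FG //|/(subsetP sD)]; by rewrite inE => /andP[].
have connG : subrel (connect (union D)) (connect G).
  by apply: connect_sub => x y /unionG; apply: connect1.
have goodP s t : (s, t) \in P -> connect G s t -> connect (union D) s t.
  by move=> stP st; have := forallP goodD (s, t); rewrite stP st.
have critical e : { q : 'I_n * 'I_n | e \in D -> [/\ q \in P,
    connect (union D) q.1 q.2 & ~~ connect (del_edge (union D) e.1 e.2) q.1 q.2] }.
  apply: constructive_indefinite_description.
  (* For [e] in [D], minimality yields a pair that loses its connection when [e] goes; elsewhere [e]
     itself is a dummy value. *)
  have [eD|_] := boolP (e \in D); last by exists e.
  have : ~~ good (D :\ e).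
    apply/negP=> gDe; have := minD _ gDe (subD1set _ _).
    by move/setP/(_ e); rewrite !inE eqxx eD.
  rewrite negb_and (subset_trans (subD1set _ _) sD) /=.
  case/forallPn=> q; rewrite !negb_imply => /and3P[qP qG nq].
  exists q => _; split=> //; first by apply: goodP; rewrite -?surjective_pairing.
  (* Deleting [e] from the whole union, [F] included, leaves a subgraph of [union (D :\ e)]. *)
  apply: contra nq; apply: connect_sub => x y /andP[uxy ne]; apply: connect1.
  by move: uxy; rewrite /union inE in_set1 -surjective_pairing in ne *; rewrite ne.
pose cl (e : {e | e \in D}) := sval (critical (val e)).
have bf : bridge_free (fun e => (val e).1) cl
    (fun e f => connect (union D) (val e).2 (val f).1) (connect (union D)).
  apply: bridge_free_critical => [[x y] eD|e eD|e|e].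
  - by rewrite /union eD orbT.
  - by apply/negP=> /connG; have := subsetP sD e eD; rewrite inE => /andP[_ /negP].
  - by have [] := svalP (critical (val e)) (valP e).
  by have [] := svalP (critical (val e)) (valP e).
have le_cl : #|cl @: setT| <= p.
  rewrite -cP; apply/subset_leq_card/subsetP=> _ /imsetP[e _ ->].
  by have [] := svalP (critical (val e)) (valP e).
exists (union D); split; first by split.
have cD : #|D| <= k + 2 * p.
  have := PO_bound_bridge_free bf _ POk; rewrite card_sig le_cl => /(_ le_pn) cD.
  by apply: leq_trans cD _; rewrite leq_add2l leq_mul2l le_cl.
have -> : nedges (union D) = #|F :|: D|.
  by apply: eq_card => -[x y]; rewrite !inE.
by apply: leq_trans (leq_card_setU _ _) (leq_add _ _).
Qed.

(** * Comparison of the two quantities *)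

Lemma RP_bound_trivial n p : RP_bound n p (n * n).
Proof.
move=> G P _; exists G; split; first by split.
by rewrite (leq_trans (max_card _)) // card_prod card_ord.
Qed.

(** If [p] pairs fit between the two halves of the nodes, [small_preserver] applies; otherwise [k]
    is already quadratic in [n] and the whole graph serves. *)
Lemma RP_bound_of_PO_bound n p k : 0 < n -> 0 < p ->
  PO_bound n p k -> RP_bound n p (9 * k).
Proof.
move=> n_gt0 p_gt0 POk G P cP.
have le_pn : p <= n * n.
  by rewrite -cP (leq_trans (max_card _)) // card_prod card_ord.
(* With one node the halves give no bound, but the empty graph is a preserver. *)
have [n1|n_neq1] := eqVneq n 1.
  subst n; exists (fun _ _ => false); split; first by split=> // s t _ _; rewrite !ord1.
  by rewrite /nedges (_ : [set _ | _] = set0) ?cards0 //; apply/setP=> e; rewrite !inE.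
pose Q := setX [set s : 'I_n | s < n./2] [set t : 'I_n | n./2 <= t].
have bipQ s t : (s, t) \in Q -> s < n./2 <= t by rewrite !inE.
have cQ : #|Q| = n./2 * (n - n./2).
  have le_hn : n./2 <= n by lia.
  rewrite cardsX card_ord_lt //; congr (_ * _).
  have -> : [set t : 'I_n | n./2 <= t] = ~: [set s : 'I_n | s < n./2].
    by apply/setP=> t; rewrite !inE -leqNgt.
  by rewrite cardsCs setCK card_ord card_ord_lt.
have [le_pQ|lt_Qp] := leqP p #|Q|.
  have [A sAQ cA] := exists_subset_card le_pQ.
  have le_pk : p <= k.
    rewrite -cA; apply: (@PO_bound_bipartite n p) POk => [s t /(subsetP sAQ)/bipQ //|].
    by rewrite cA leqnn.
  have le_nk := PO_bound_order (introT andP (conj p_gt0 le_pn)) POk.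
  have [H [HP cH]] := small_preserver G cP le_pn POk.
  (* From [n <= k + 2] and [1 <= p <= k] the edges number at most [5 * k + 4 <= 9 * k]. *)
  exists H; split=> //; apply: leq_trans cH _; lia.
have le_Qk : #|Q| <= k.
  by apply: (@PO_bound_bipartite n p) POk => //; rewrite (ltnW lt_Qp).
have [H [HP cH]] := @RP_bound_trivial n p G P cP.
exists H; split=> //; apply: leq_trans cH _.
have : n * n <= 9 * (n./2 * (n - n./2)) by nia.
rewrite -cQ; lia.
Qed.

(* A preserver is stored as the list of its edges; [None] pads the list to length [k]. *)
Lemma PO_bound_of_RP_bound n p k : 0 < n ->
  RP_bound n p k -> PO_bound n p (4 * k * trunc_log 2 n).
Proof.
move=> n_gt0 RPk; have [n1|n_neq1] := eqVneq n 1.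
  (* For [n = 1] the logarithm is [0], and the fixed answer is the empty path, without any bits. *)
  subst n; exists (fun _ _ _ => Some [::]) => G P _; exists [::]; split=> // s t _.
  by rewrite !ord1 connect0; exists [::].
have finder (H : rel 'I_n) s t : { o : option (seq 'I_n) | if connect H s t then
    exists q, o = Some q /\ path H s q /\ last s q = t else o = None }.
  apply: constructive_indefinite_description; case: connectP => [[q pq lq]|_].
    by exists (Some q), q.
  by exists None.
set L := trunc_log 2 n.
pose E := option ('I_n * 'I_n).
have L_gt0 : 0 < L by rewrite trunc_log_gt0; lia.
(* With [L >= 1], [n < 2 ^ (L + 1) <= 2 ^ (2 * L)], so the [n * n + 1] values of [E] fit into
   [4 * L] bits; hence the factor [4]. *)
have cE : #|{: k.-tuple E}| <= #|{: (4 * k * L).-tuple bool}|.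
  rewrite !card_tuple card_bool card_option card_prod card_ord.
  have -> : 4 * k * L = (L + L) * 2 * k by lia.
  rewrite expnM; case: k {RPk} => [//|k]; rewrite leq_exp2r // expnM expnS expn1.
  suff lt_n : n < 2 ^ (L + L) by nia.
  by apply: leq_trans (@trunc_log_ltn 2 n isT) _; rewrite leq_exp2l //; lia.
pose enc (t : k.-tuple E) := enum_val (widen_ord cE (enum_rank t)).
have enc_inj : injective enc.
  move=> t t' /enum_val_inj/(congr1 val)/= eq_rk.
  exact/enum_rank_inj/val_inj.
pose gr (t : k.-tuple E) : rel 'I_n := fun x y => Some (x, y) \in t.
exists (fun b s t => if [pick u | val (enc u) == b] is Some u
                     then sval (finder (gr u) s t) else None) => G P cP.
have [H [[HG HP] cH]] := RPk G P cP.
pose es := [set e : 'I_n * 'I_n | H e.1 e.2].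
have sz : size ([seq Some e | e <- enum es] ++ nseq (k - #|es|) None) == k.
  by rewrite size_cat size_map -cardE size_nseq subnKC.
pose u : k.-tuple E := Tuple sz.
have grH : gr u =2 H.
  move=> x y; rewrite /gr [_ \in _]mem_cat mem_nseq andbF orbF.
  by rewrite mem_map ?mem_enum ?inE // => a b [].
exists (enc u); split=> [|s t stP]; first by rewrite size_tuple.
case: pickP => [u' /eqP/val_inj/enc_inj ->|/(_ u)]; last by rewrite eqxx.
have conHG : connect H s t = connect G s t.
  apply/idP/idP; last exact: HP.
  by apply: connect_sub => x y /HG; apply: connect1.
case: (finder (gr u) s t) => o /=; rewrite (eq_connect grH) conHG.
case: ifP => // _ [q [-> [pq lq]]]; exists q; split=> //; split=> //.
by apply: sub_path pq => x y; rewrite grH; apply: HG.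
Qed.

(* Omega(RP(n,p)) <= PO(n,p) <= O(RP(n,p) log n), for all positive n, p.
   log n is taken as floor(log2 n) (trunc_log 2 n). *)
Theorem theorem4p16 :
  exists c C : nat, 0 < c /\ 0 < C /\
    forall n p : nat, 0 < n -> 0 < p ->
      RP n p <= c * PO n p /\ PO n p <= C * RP n p * trunc_log 2 n.
Proof.
exists 9, 4; do 2!split=> //; move=> n p n_gt0 p_gt0.
have [RPb RPmin] := least_natP (ex_intro _ _ (@RP_bound_trivial n p)).
have PObRP := PO_bound_of_RP_bound n_gt0 RPb.
have [POb POmin] := least_natP (ex_intro _ _ PObRP).
by split; [apply/RPmin/RP_bound_of_PO_bound | apply: POmin].
Qed.
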